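(* Let $0\le\alpha<1$ be fixed. Consider a Stochastic Block Model $\mathcal G(m,n-m,p,q)$ with two communities (with $m,p,q$ depending on $n$, $m>n/2$ and $p>q$) such that $w_{\min}=\omega(\log^3(n))$ and $\frac{w_{\max}}{w_{\min}}\le C$ for a constant $C$ independent of $n$. Let $\boldsymbol\pi$ be the PageRank vector with damping factor $\alpha$ and preference (probability) vector $\mathbf v=\mathbf v^{(n)}$ such that $\|\mathbf v\|_2=O(1/\sqrt n)$. Then w.h.p. $$\|\boldsymbol\pi-\overline{\boldsymbol\pi}_{\mathrm{SBM}}\|_{TV}=o(1),$$ where $$\overline{\boldsymbol\pi}_{\mathrm{SBM}}=(1-\alpha)\left(\mathbf I-\alpha\overline{\mathbf P}\right)^{-1}\mathbf v,$$ $\overline{\mathbf P}=\overline{\mathbf A}\,\mathbf W^{-1}$ is the ''average'' Markov matrix, $\mathbf W=\mathbb E(\mathbf D)$ and $\overline{\mathbf A}=\mathbb E(\mathbf A)$.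
   Context: Stochastic Block Model $\mathcal G(m,n-m,p,q)$ with two communities: an undirected random graph on $V=C_1\cup C_2$, $C_1,C_2$ disjoint, $|C_1|=m$, $|C_2|=n-m$, $m>n/2$; edges are independent; two vertices in the same community are joined with probability $p$ and two vertices in different communities with probability $q$, with $p>q$; $p,q$ may scale with $n$. Self-loops ($i=j$) are allowed with probability $p$, so that expected degrees are exactly $mp+(n-m)q$ on $C_1$ and $(n-m)p+mq$ on $C_2$. $w_{\max}=mp+(n-m)q$ and $w_{\min}=(n-m)p+mq$ are the maximum and minimum expected degrees. $\mathbf A$ is the symmetric $0/1$ adjacency matrix, $\mathbf D=\mathrm{diag}(d_1,\dots,d_n)$ with $d_i=\sum_jA_{ij}$, $\mathbf P=\mathbf A\mathbf D^{-1}$ (defined when all degrees are positive, part of the w.h.p. event). PageRank: for a (deterministic) probability vector $\mathbf v$ and $\alpha<1$, $\boldsymbol\pi=(1-\alpha)[\mathbf I-\alpha\mathbf P]^{-1}\mathbf v$, equivalently the stationary probability vector of $\alpha\mathbf P+(1-\alpha)\mathbf v\mathbf 1^T$. $\|u-v\|_{TV}=\frac12\sum_i|u_i-v_i|$; $\|\mathbf x\|_2=\sqrt{\sum_i|x_i|^2}$. $f(n)=\omega(g(n))$ means $g(n)=o(f(n))$ as $n\to\infty$. An event (depending on $n$) holds with high probability (w.h.p.) if there are $N$ and $c>0$ such that its probability is at least $1-O(n^{-c})$ for all $n>N$. Nonnegative random variables $X_n$ satisfy $X_n=o(1)$ w.h.p. if there is a deterministic function $\psi(n)=o(1)$ such that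 the event $\{X_n\le\psi(n)\}$ holds w.h.p. *)

(* Defs.v *)
From HB Require Import structures.
From mathcomp Require Import all_boot all_order all_algebra.
From mathcomp Require Import all_classical all_reals all_analysis.

Set Implicit Arguments.
Unset Strict Implicit.
Unset Printing Implicit Defensive.

Import Order.TTheory GRing.Theory Num.Theory.
Import numFieldNormedType.Exports.

Local Open Scope classical_set_scope.
Local Open Scope ring_scope.

(* The stochastic block model as a finite probability space: a graph on 'I_n
   is a choice of presence/absence for every unordered pair of (possibly
   equal) vertices, the pair {i, j} being encoded by (i, j) with i <= j.
   Independence of the edges is the product form of [sbm_weight]. *)

Definition pair_le n (e : 'I_n * 'I_n) : bool := (e.1 <= e.2)%N.

Definition slot n := {e : 'I_n * 'I_n | pair_le e}.

Definition graph n := {ffun slot n -> bool}.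

Definition sort_pair n (i j : 'I_n) : 'I_n * 'I_n :=
  if (i <= j)%N then (i, j) else (j, i).

Lemma sort_pairP n (i j : 'I_n) : pair_le (sort_pair i j).
Proof.
rewrite /sort_pair /pair_le; case: ifPn => //= ij.
by rewrite ltnW // ltnNge.
Qed.

Definition slot_of n (i j : 'I_n) : slot n :=
  Sub (sort_pair i j) (sort_pairP i j).

Section Model.
Variables (R : realType) (n : nat).

Definition adjacency (g : graph n) : 'M[R]_n :=
  \matrix_(i, j) (g (slot_of i j))%:R.

Definition degree (g : graph n) (i : 'I_n) : R := \sum_j adjacency g i j.

Definition degree_mx (g : graph n) : 'M[R]_n :=
  diag_mx (\row_i degree g i).

Definition walk_mx (g : graph n) : 'M[R]_n :=
  adjacency g *m invmx (degree_mx g).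

(* The two communities are C and its complement. *)
Definition edge_prob (C : {set 'I_n}) (p q : R) (i j : 'I_n) : R :=
  if (i \in C) == (j \in C) then p else q.

Definition sbm_weight (C : {set 'I_n}) (p q : R) (g : graph n) : R :=
  \prod_(e : slot n)
    (let r := edge_prob C p q (val e).1 (val e).2 in
     if g e then r else 1 - r).

Definition sbm_pr (C : {set 'I_n}) (p q : R) (E : pred (graph n)) : R :=
  \sum_(g | E g) sbm_weight C p q g.

Definition sbm_mean (C : {set 'I_n}) (p q : R) (X : graph n -> 'M[R]_n) :
    'M[R]_n :=
  \sum_g sbm_weight C p q g *: X g.

Definition mean_adjacency (C : {set 'I_n}) (p q : R) : 'M[R]_n :=
  sbm_mean C p q adjacency.

Definition mean_degree_mx (C : {set 'I_n}) (p q : R) : 'M[R]_n :=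
  sbm_mean C p q degree_mx.

Definition mean_walk_mx (C : {set 'I_n}) (p q : R) : 'M[R]_n :=
  mean_adjacency C p q *m invmx (mean_degree_mx C p q).

Definition pagerank (alpha : R) (P : 'M[R]_n) (v : 'cV[R]_n) : 'cV[R]_n :=
  (1 - alpha) *: (invmx (1%:M - alpha *: P) *m v).

Definition prob_vector (v : 'cV[R]_n) : Prop :=
  (forall i, 0 <= v i 0) /\ \sum_i v i 0 = 1.

Definition tv_dist (u v : 'cV[R]_n) : R := 2^-1 * \sum_i `|u i 0 - v i 0|.

Definition norm2 (v : 'cV[R]_n) : R := Num.sqrt (\sum_i `|v i 0| ^+ 2).

Definition wmax (m : nat) (p q : R) : R := m%:R * p + (n - m)%:R * q.

Definition wmin (m : nat) (p q : R) : R := (n - m)%:R * p + m%:R * q.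

End Model.

Arguments wmax {R} n m p q.
Arguments wmin {R} n m p q.

(* [prob n] is the probability of the n-th event. *)
Definition whp (R : realType) (prob : nat -> R) : Prop :=
  exists (N : nat) (c K : R), 0 < c /\
    forall n, (N < n)%N -> 1 - K * n%:R `^ (- c) <= prob n.

(* Positivity of the degrees is part of the event, since [walk_mx] only has
   its intended meaning when all degrees are positive. *)
Definition pagerank_close (R : realType) n (alpha : R) (v : 'cV[R]_n)
    (pibar : 'cV[R]_n) (eps : R) : pred (graph n) :=
  fun g => [forall i, 0 < degree R g i] &&
    (tv_dist (pagerank alpha (walk_mx R g) v) pibar <= eps).

Lemma sbm_pr_total (R : realType) n (C : {set 'I_n}) (p q : R) :
  sbm_pr C p q predT = 1.
Proof.
pose r (e : slot n) := edge_prob C p q (val e).1 (val e).2.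
transitivity (\prod_(e : slot n) \sum_(b : bool) (if b then r e else 1 - r e)).
  by rewrite bigA_distr_bigA.
by rewrite big1 // => e _; rewrite big_bool /= addrC subrK.
Qed.

Lemma mean_adjacencyE (R : realType) n (C : {set 'I_n}) (p q : R) :
  mean_adjacency C p q = \matrix_(i, j) edge_prob C p q i j.
Proof.
apply/matrixP => i j; rewrite summxE mxE.
pose r (e : slot n) := edge_prob C p q (val e).1 (val e).2.
pose e0 := slot_of i j.
pose F (e : slot n) (b : bool) :=
  (if b then r e else 1 - r e) * (if e == e0 then b%:R else 1).
transitivity (\prod_(e : slot n) \sum_(b : bool) F e b).
  rewrite bigA_distr_bigA; apply: eq_bigr => g _.
  rewrite !mxE big_split /=; congr (_ * _).
  by rewrite -big_mkcond big_pred1_eq.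
rewrite (bigD1 e0) //= [X in _ * X]big1 => [|e /negPf ee0].
  rewrite big_bool /F eqxx /= !mulr1 mulr0 addr0 /r /e0 /= /sort_pair.
  by case: ifP => //= _; rewrite /edge_prob eq_sym.
by rewrite big_bool /F ee0 /= !mulr1 addrC subrK.
Qed.

Lemma mean_degree_mxE (R : realType) n (C : {set 'I_n}) (p q : R) :
  mean_degree_mx C p q =
  diag_mx (\row_i (if i \in C then wmax n #|C| p q else wmin n #|C| p q)).
Proof.
have meanA i j : \sum_g sbm_weight C p q g * adjacency R g i j =
    edge_prob C p q i j.
  move/matrixP: (mean_adjacencyE C p q) => /(_ i j).
  rewrite summxE mxE => <-.
  by apply: eq_bigr => g _; rewrite !mxE.
apply/matrixP => i j; rewrite summxE mxE mxE.
have [->|ij] := eqVneq i j; last first.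
  by rewrite mulr0n big1 // => g _; rewrite !mxE (negPf ij) mulr0n mulr0.
rewrite mulr1n.
transitivity (\sum_k edge_prob C p q j k).
  under [RHS]eq_bigr => k _ do rewrite -meanA.
  rewrite exchange_big /=; apply: eq_bigr => g _.
  by rewrite !mxE eqxx mulr1n /degree mulr_sumr.
have cC : (n - #|C|)%N = #|~: C|.
  by apply/eqP; rewrite -(eqn_add2l #|C|) cardsC card_ord subnKC // -[leqRHS]card_ord max_card.
rewrite /edge_prob /wmax /wmin cC (bigID (mem C)) /=.
have -> : \sum_(k in C) (if (j \in C) == (k \in C) then p else q) =
    #|C|%:R * (if j \in C then p else q).
  rewrite mulr_natl -sumr_const; apply: eq_bigr => k ->.
  by case: (j \in C).
have -> : \sum_(k | k \notin C) (if (j \in C) == (k \in C) then p else q) =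
    #|~: C|%:R * (if j \in C then q else p).
  rewrite mulr_natl -sumr_const; apply: eq_big => k; first by rewrite inE.
  by move/negPf=> ->; case: (j \in C).
by case: (j \in C) => //; rewrite addrC.
Qed.

(* Main.v *)
Require Import Defs.
From mathcomp Require Import all_boot all_order all_algebra.
From mathcomp Require Import all_classical all_reals all_analysis.
From mathcomp Require Import ring lra.

Import Order.TTheory GRing.Theory Num.Theory.
Import numFieldNormedType.Exports.

Set Implicit Arguments.
Unset Strict Implicit.
Unset Printing Implicit Defensive.

Local Open Scope classical_set_scope.
Local Open Scope ring_scope.

(** The averaged PageRank vector z is deterministic, so the random walk matrix
    has to be compared with its average on one fixed vector only.  Both walk matrices P and Q (the
    averaged one) are column stochastic, hence contract the l1 norm.  If x is
    the PageRank vector of P, subtracting the two fixed-point equations gives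
    x - z = alpha P (x - z) + alpha (P - Q) z, so
    |x - z|_1 <= alpha / (1 - alpha) |(P - Q) z|_1 ([l1_pagerank_sub_le]), and
    only the action of P - Q on the fixed vector z matters.

    Write w_j for the expected degrees, w for a lower bound on them, d_j for
    the random degrees and y_j = z_j / w_j.  Splitting A D^-1 - A' W^-1 (with
    A' = E A) as (A - A') W^-1 + A (D^-1 - W^-1) bounds |(P - Q) z|_1 by
    sum_i |((A - A') y)_i| + sum_j |d_j - w_j| |y_j|, the [discrepancy].

    The mean of the discrepancy is controlled by second moments.  The variance
    of row i is at most sum_j A'_ij y_j^2, and these sum to
    sum_j z_j^2 / w_j, the [energy] of z.  The averaged walk, being reversible,
    does not increase this energy (Cauchy-Schwarz), so neither does PageRank,
    and the energy of z is at most |v|_2^2 / w = O(1 / (n w)).  The mean is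
    thus eta + O(1 / (eta w)) for every eta > 0.

    The discrepancy is also a Lipschitz function of independent edges: flipping
    edge {i, j} moves it by at most 2 (|y_i| + |y_j|), and the squares of these
    constants add up to O(n |y|_2^2) = O(w^-2).  The bounded-differences
    inequality of McDiarmid then gives a tail of order exp(-t) beyond t / w
    above the mean ([discrepancy_tail]); t = ln n makes the failure
    probability O(1/n), while eta = 1 / ln n and ln n = o(w) make the bound
    vanish.  Finally some vertex is isolated with probability at most
    n exp(-w) <= 1 / n, since eventually w >= 2 ln n. *)

(** * Concentration for functions of independent bits *)

(** On a centered variable the linear term integrates to zero, so this bound
    turns an exponential moment into a Gaussian one.  For x <= 1/2 it follows
    from expR x <= 1 / (1 - x) <= 1 + x + 2 x^2; beyond, x <= 2 x^2. *)
Lemma expR_le_linear_sqr (R : realType) (x : R) :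
  expR x <= x + expR (2 * x ^+ 2).
Proof.
have [x_le|/ltW x_ge] := leP x 2^-1; last first.
  have : expR x <= expR (2 * x ^+ 2) by rewrite ler_expR; nra.
  lra.
have inv_bound : expR x * (1 - x) <= 1.
  rewrite -[leRHS](expRxMexpNx_1 x) ler_wpM2l ?expR_ge0 //.
  by have := expR_ge1Dx (- x); lra.
have : expR x * (1 - x) <= (1 + x + 2 * x ^+ 2) * (1 - x).
  by apply: (le_trans inv_bound); nra.
rewrite ler_pM2r; last lra.
by have := expR_ge1Dx (2 * x ^+ 2); lra.
Qed.

(** A weak form of Hoeffding's lemma for a variable with two values: the
    constant 2 is that of [expR_le_linear_sqr], the optimal one is 1/8. *)
Lemma hoeffding_two_point (R : realType) (rho a b c : R) :
  0 <= rho <= 1 -> `|a - b| <= c ->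
  rho * expR (a - (rho * a + (1 - rho) * b)) +
  (1 - rho) * expR (b - (rho * a + (1 - rho) * b)) <= expR (2 * c ^+ 2).
Proof.
move=> /andP[rho0 rho1] abc; set mu := rho * a + (1 - rho) * b.
have c0 : 0 <= c by apply: le_trans abc.
have devs x : `|x| <= c -> expR x <= x + expR (2 * c ^+ 2).
  move=> xc; apply: (le_trans (expR_le_linear_sqr x)).
  rewrite lerD2l ler_expR ler_pM2l // -real_normK ?num_real //.
  by rewrite lerXn2r // nnegrE.
have aE : a - mu = (1 - rho) * (a - b) by rewrite /mu; ring.
have bE : b - mu = - (rho * (a - b)) by rewrite /mu; ring.
have am : `|a - mu| <= c.
  rewrite aE normrM ger0_norm ?subr_ge0 //.
  by apply: le_trans abc; rewrite ler_piMl //; lra.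
have bm : `|b - mu| <= c.
  rewrite bE normrN normrM ger0_norm //.
  by apply: le_trans abc; rewrite ler_piMl.
have rho'0 : 0 <= 1 - rho by rewrite subr_ge0.
have := lerD (ler_wpM2l rho0 (devs _ am)) (ler_wpM2l rho'0 (devs _ bm)).
by rewrite {2}aE {2}bE; lra.
Qed.

Section BernoulliProduct.
Variables (R : realType) (S : finType) (r : S -> R).
Implicit Types (f h : {ffun S -> bool} -> R) (g : {ffun S -> bool}) (e : S).

Definition bern_mass (e : S) (b : bool) : R := if b then r e else 1 - r e.

Definition mean (f : {ffun S -> bool} -> R) : R :=
  \sum_(g : {ffun S -> bool}) (\prod_e bern_mass e (g e)) * f g.

Definition set_bit (g : {ffun S -> bool}) (e : S) (b : bool) :
  {ffun S -> bool} := [ffun e' => if e' == e then b else g e'].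

(** The conditional expectation of f given all the bits other than e. *)
Definition resample (e : S) (f : {ffun S -> bool} -> R) (g : {ffun S -> bool}) :
  R := r e * f (set_bit g e true) + (1 - r e) * f (set_bit g e false).

Lemma mean_cst (k : R) : mean (fun=> k) = k.
Proof.
rewrite /mean -mulr_suml -(bigA_distr_bigA bern_mass) big1 ?mul1r // => e _.
by rewrite big_bool /bern_mass /= addrC subrK.
Qed.

Lemma meanD f h : mean (fun g => f g + h g) = mean f + mean h.
Proof. by rewrite /mean -big_split; apply: eq_bigr => g _; rewrite mulrDr. Qed.

Lemma meanZ (k : R) f : mean (fun g => k * f g) = k * mean f.
Proof. by rewrite /mean mulr_sumr; apply: eq_bigr => g _; rewrite mulrCA. Qed.

Lemma mean_sum (I : finType) (F : I -> {ffun S -> bool} -> R) :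
  mean (fun g => \sum_i F i g) = \sum_i mean (F i).
Proof.
by rewrite /mean exchange_big; apply: eq_bigr => g _; rewrite mulr_sumr.
Qed.

Lemma eq_mean f h : f =1 h -> mean f = mean h.
Proof. by move=> fh; apply: eq_bigr => g _; rewrite fh. Qed.

(** The law of total expectation.  It carries all uses of independence below
    except the product formula for absent edges. *)
Lemma mean_resample e f : mean (resample e f) = mean f.
Proof.
pose rest g := \prod_(e' | e' != e) bern_mass e' (g e').
(* The mass of a configuration factors as the mass of bit e times [rest]; so
   each side is a combination of the contributions [half] of the two values. *)
pose half b := \sum_(g : {ffun S -> bool} | g e == b) rest g * f g.
have massE g : \prod_e' bern_mass e' (g e') = bern_mass e (g e) * rest g.
  by rewrite (bigD1 e).
have rest_set g b : rest (set_bit g e b) = rest g.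
  by apply: eq_bigr => e' /negPf ne; rewrite ffunE ne.
have set_bitK g b : set_bit (set_bit g e b) e (g e) = g.
  by apply/ffunP => e'; rewrite !ffunE; case: eqP => // ->.
have halfE b b' : \sum_(g : {ffun S -> bool} | g e == b')
    rest g * f (set_bit g e b) = half b.
  rewrite [RHS](reindex_onto (fun g => set_bit g e b)
                          (fun g => set_bit g e b')) /=; last first.
    by move=> g /eqP <-; rewrite set_bitK.
  apply: eq_big => [g|g _]; last by rewrite rest_set.
  rewrite ffunE eqxx eqxx /=; apply/eqP/eqP => [<-|<-]; first exact: set_bitK.
  by rewrite ffunE eqxx.
have by_value (F : {ffun S -> bool} -> R) :
    mean F = \sum_b bern_mass e b *
      \sum_(g : {ffun S -> bool} | g e == b) rest g * F g.
  rewrite /mean (partition_big (fun g => g e) xpredT) //=.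
  apply: eq_bigr => b _; rewrite mulr_sumr; apply: eq_bigr => g /eqP <-.
  by rewrite massE mulrA.
rewrite !by_value.
have -> : \sum_b bern_mass e b *
      \sum_(g : {ffun S -> bool} | g e == b) rest g * resample e f g =
    \sum_b bern_mass e b * (r e * half true + (1 - r e) * half false).
  apply: eq_bigr => b _; congr (_ * _).
  rewrite -(halfE true b) -(halfE false b) !mulr_sumr -big_split.
  by apply: eq_bigr => g _; rewrite /resample /=; ring.
rewrite -mulr_suml !big_bool /= /half; ring.
Qed.

Hypothesis r01 : forall e, 0 <= r e <= 1.

Lemma bern_mass_ge0 e b : 0 <= bern_mass e b.
Proof.
by have /andP[r0 r1] := r01 e; case: b; rewrite /bern_mass ?subr_ge0.
Qed.

Lemma ler_mean f h : (forall g, f g <= h g) -> mean f <= mean h.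
Proof.
move=> fh; apply: ler_sum => g _; rewrite ler_wpM2l //.
by apply: prodr_ge0 => e _; apply: bern_mass_ge0.
Qed.

(** Integrate out the bits one at a time: conditionally on the others, bit e
    contributes a factor expR (2 c_e^2) by Hoeffding's lemma, and resampling
    preserves both the Lipschitz constants of f and its mean.  The induction
    is on the list s of the bits that f still depends on. *)
Lemma expR_bounded_differences (s : seq S) (c : S -> R) f :
  (forall e g g', (forall e', e' != e -> g e' = g' e') ->
     `|f g - f g'| <= c e) ->
  (forall g g', {in s, g =1 g'} -> f g = f g') ->
  mean (fun g => expR (f g - mean f)) <= expR (2 * \sum_(e <- s) c e ^+ 2).
Proof.
elim: s f => [|e s IHs] f f_lip f_dep.
  have f_cst g : f g = f [ffun=> false] by apply: f_dep.
  under eq_mean => g do rewrite f_cst.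
  rewrite mean_cst big_nil mulr0 (eq_mean f_cst) mean_cst subrr //.
pose h := resample e f.
have h_lip e' g g' : (forall e'', e'' != e' -> g e'' = g' e'') ->
    `|h g - h g'| <= c e'.
  move=> gg'.
  have f_set b : `|f (set_bit g e b) - f (set_bit g' e b)| <= c e'.
    by apply: f_lip => e'' ne; rewrite !ffunE; case: eqP => // _; apply: gg'.
  have := f_set true; have := f_set false; have /andP[r0 r1] := r01 e.
  rewrite /h /resample !ler_norml => /andP[? ?] /andP[? ?].
  apply/andP; split; nra.
have h_dep g g' : {in s, g =1 g'} -> h g = h g'.
  move=> gg'; rewrite /h /resample.
  have f_set b : f (set_bit g e b) = f (set_bit g' e b).
    apply: f_dep => e'; rewrite inE !ffunE; case: eqP => //= _; exact: gg'.
  by rewrite !f_set.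
rewrite big_cons mulrDr expRD.
apply: le_trans (ler_wpM2l (expR_ge0 _) (IHs h h_lip h_dep)).
rewrite mean_resample -meanZ -[leLHS](mean_resample e); apply: ler_mean => g.
set h' := h g; rewrite {1}/resample.
have split_expR x : expR (x - mean f) = expR (x - h') * expR (h' - mean f).
  by rewrite -expRD; congr expR; ring.
rewrite split_expR (split_expR (f (set_bit g e false))).
rewrite (mulrA (r e)) (mulrA (1 - r e)) -mulrDl ler_wpM2r ?expR_ge0 //.
rewrite /h' /h /resample; apply: (hoeffding_two_point (r01 e)).
by apply: f_lip => e' /negPf ne; rewrite !ffunE ne.
Qed.

(** McDiarmid's inequality before optimization: Markov's inequality for the
    exponential moment.  The free parameter of the usual statement is obtained
    by scaling f. *)
Lemma bounded_differences_tail (c : S -> R) f (t : R) :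
  (forall e g g', (forall e', e' != e -> g e' = g' e') ->
     `|f g - f g'| <= c e) ->
  mean (fun g => (mean f + t < f g)%R%:R) <=
    expR (2 * \sum_e c e ^+ 2 - t).
Proof.
move=> f_lip; rewrite [_ - t]addrC expRD -big_enum /=.
have f_dep g g' : {in enum S, g =1 g'} -> f g = f g'.
  by move=> gg'; congr f; apply/ffunP => e; apply: gg'; rewrite mem_enum.
apply: le_trans (ler_wpM2l (expR_ge0 _) (expR_bounded_differences f_lip f_dep)).
rewrite -meanZ; apply: ler_mean => g; rewrite -expRD.
case: ltP => [lt|_]; last exact: expR_ge0.
by rewrite -expR0 ler_expR; lra.
Qed.

Section DistinctSlots.
Variables (J : finType) (sigma : J -> S).
Hypothesis sigma_inj : injective sigma.

(** Distinct bits are uncorrelated, so only the variances r (1 - r) <= r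
    remain when the square is expanded. *)
Lemma mean_sqr_centered_le (y : J -> R) :
  mean (fun g => (\sum_j ((g (sigma j))%:R - r (sigma j)) * y j) ^+ 2) <=
  \sum_j r (sigma j) * y j ^+ 2.
Proof.
pose dev j g : R := (g (sigma j))%:R - r (sigma j).
have covE j k : mean (fun g => dev j g * dev k g) =
    if j == k then r (sigma j) * (1 - r (sigma j)) else 0.
  rewrite -(mean_resample (sigma j)); case: eqVneq => [<-|jk].
    rewrite -[RHS]mean_cst; apply: eq_mean => g.
    rewrite /resample /dev !ffunE eqxx /=; ring.
  rewrite -(mean_cst 0); apply: eq_mean => g.
  have /negPf kj : sigma k != sigma j by rewrite (inj_eq sigma_inj) eq_sym.
  rewrite /resample /dev !ffunE eqxx kj /=; ring.
have -> : mean (fun g => (\sum_j dev j g * y j) ^+ 2) =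
    \sum_j \sum_k y j * y k * mean (fun g => dev j g * dev k g).
  under eq_mean => g do rewrite expr2 mulr_suml.
  rewrite mean_sum; apply: eq_bigr => j _.
  under eq_mean => g do rewrite mulr_sumr.
  rewrite mean_sum; apply: eq_bigr => k _.
  by rewrite -meanZ; apply: eq_mean => g; ring.
apply: ler_sum => j _; rewrite (bigD1 j) //= big1 => [|k kj]; last first.
  by rewrite covE eq_sym (negPf kj) mulr0.
rewrite covE eqxx addr0.
have /andP[r0 r1] := r01 (sigma j).
have := sqr_ge0 (y j); nra.
Qed.

Lemma mean_all_absent_le :
  mean (fun g => [forall j, ~~ g (sigma j)]%:R) <= expR (- \sum_j r (sigma j)).
Proof.
have absentE g : [forall j, ~~ g (sigma j)]%:R =
    \prod_e (~~ ((e \in codom sigma) && g e))%:R :> R.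
  have [/forallP absent|/forallPn[j]] := boolP [forall j, ~~ g (sigma j)].
    rewrite big1 // => e _; case: (boolP (e \in _)) => //= /codomP[j ->].
    by rewrite absent.
  by rewrite negbK => gj; rewrite (bigD1 (sigma j)) //= codom_f gj mul0r.
have -> : mean (fun g => [forall j, ~~ g (sigma j)]%:R) =
    \prod_(e in codom sigma) (1 - r e).
  transitivity (\prod_e \sum_b
      bern_mass e b * (~~ ((e \in codom sigma) && b))%:R).
    rewrite bigA_distr_bigA; apply: eq_bigr => g _.
    by rewrite absentE -big_split.
  rewrite [RHS]big_mkcond; apply: eq_bigr => e _; rewrite big_bool /bern_mass.
  by case: (e \in codom sigma) => /=; ring.
have codom_uniq : uniq (codom sigma) by rewrite map_inj_uniq ?enum_uniq.
rewrite -big_uniq //= codomE big_map big_enum /= -sumrN expR_sum.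
apply: ler_prod => j _; have /andP[r0 r1] := r01 (sigma j).
by rewrite subr_ge0 r1 expR_ge1Dx.
Qed.
End DistinctSlots.

End BernoulliProduct.

(** * PageRank of an l1 contraction *)

Section L1Norm.
Variables (R : realType) (n : nat).
Implicit Types (u v : 'cV[R]_n) (P Q : 'M[R]_n).

Definition l1 (u : 'cV[R]_n) : R := \sum_i `|u i 0|.

Definition l1_contraction (P : 'M[R]_n) : Prop :=
  forall u, l1 (P *m u) <= l1 u.

Lemma l1_ge0 u : 0 <= l1 u. Proof. by apply: sumr_ge0. Qed.

Lemma l1D u v : l1 (u + v) <= l1 u + l1 v.
Proof. by rewrite /l1 -big_split ler_sum // => i _; rewrite mxE ler_normD. Qed.

Lemma l1Z (k : R) u : l1 (k *: u) = `|k| * l1 u.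
Proof. by rewrite /l1 mulr_sumr; apply: eq_bigr => i _; rewrite mxE normrM. Qed.

Lemma l1_eq0 u : l1 u <= 0 -> u = 0.
Proof.
move=> u0; have /eqP : l1 u = 0 by apply/eqP; rewrite eq_le u0 l1_ge0.
rewrite psumr_eq0 // => /allP all0; apply/matrixP => i j.
rewrite ord1 mxE; apply/eqP; rewrite -normr_eq0.
exact: (implyP (all0 i (mem_index_enum i))).
Qed.

Lemma l1_contraction_col P : (forall j, \sum_i `|P i j| <= 1) -> l1_contraction P.
Proof.
move=> P1 u; apply: (@le_trans _ _ (\sum_i \sum_j `|P i j| * `|u j 0|)).
  apply: ler_sum => i _; rewrite mxE.
  apply: (le_trans (ler_norm_sum _ _ _)).
  by apply: ler_sum => j _; rewrite normrM.
rewrite exchange_big; apply: ler_sum => j _.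
by rewrite -mulr_suml ler_piMl.
Qed.

Variable alpha : R.
Hypothesis alpha01 : 0 <= alpha < 1.

Let alpha_ge0 : 0 <= alpha. Proof. by case/andP: alpha01. Qed.
Let alpha_lt1 : alpha < 1. Proof. by case/andP: alpha01. Qed.

(** A kernel vector u satisfies u = alpha P u, hence |u|_1 <= alpha |u|_1. *)
Lemma unitmx_l1_contraction P :
  l1_contraction P -> 1%:M - alpha *: P \in unitmx.
Proof.
move=> P1; rewrite -unitmx_tr -row_free_unit; apply: inj_row_free => u uA0.
have fixu : u^T = alpha *: (P *m u^T).
  apply/eqP; rewrite -subr_eq0 scalemxAl -{1}[u^T]mul1mx -mulmxBl.
  by rewrite -(inj_eq trmx_inj) trmx_mul trmxK uA0 trmx0.
apply: trmx_inj; rewrite trmx0; apply: l1_eq0.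
have : l1 u^T <= alpha * l1 u^T.
  by rewrite {1}fixu l1Z ger0_norm // ler_wpM2l.
have := l1_ge0 u^T; have := alpha_lt1; nra.
Qed.

Lemma pagerank_fixpoint P v : l1_contraction P ->
  pagerank alpha P v =
  (1 - alpha) *: v + alpha *: (P *m pagerank alpha P v).
Proof.
move=> P1; apply/eqP; rewrite -subr_eq scalemxAl.
rewrite -[X in X - _]mul1mx -mulmxBl /pagerank -scalemxAr mulKVmx //.
exact: unitmx_l1_contraction.
Qed.

Lemma l1_pagerank_le P v : l1_contraction P -> l1 (pagerank alpha P v) <= l1 v.
Proof.
move=> P1; have := pagerank_fixpoint v P1; move: (pagerank _ _ _) => x xE.
have : l1 x <= (1 - alpha) * l1 v + alpha * l1 x.
  rewrite {1}xE; apply: (le_trans (l1D _ _)).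
  rewrite !l1Z !ger0_norm ?subr_ge0 ?(ltW alpha_lt1) //.
  by rewrite lerD2l ler_wpM2l.
have := alpha_lt1; nra.
Qed.

(** Stability of PageRank: the perturbation of the matrix is only tested on the
    PageRank vector of Q, which is the one that can be taken deterministic. *)
Lemma l1_pagerank_sub_le P Q v : l1_contraction P -> l1_contraction Q ->
  l1 (pagerank alpha P v - pagerank alpha Q v) <=
  alpha / (1 - alpha) * l1 ((P - Q) *m pagerank alpha Q v).
Proof.
move=> P1 Q1; have := pagerank_fixpoint v Q1; have := pagerank_fixpoint v P1.
move: (pagerank _ P _) (pagerank _ Q _) => x y xE yE.
have a1 : 0 < 1 - alpha by rewrite subr_gt0.
set d := x - y; set z := (P - Q) *m y.
have dE : d = alpha *: (P *m d) + alpha *: z.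
  rewrite {1}/d {1}xE {1}yE opprD addrACA subrr add0r -scalerBr -scalerDr; congr (_ *: _).
  by rewrite /z /d mulmxBr mulmxBl addrA subrK.
have : l1 d <= alpha * l1 d + alpha * l1 z.
  rewrite {1}dE; apply: (le_trans (l1D _ _)).
  by rewrite !l1Z !ger0_norm // lerD2r ler_wpM2l.
by rewrite mulrAC ler_pdivlMr //; lra.
Qed.
End L1Norm.

(** * Random walk on a symmetric kernel *)

(** Cauchy-Schwarz, from the variance identity: the gap between the two sides is
    half of sum_jk a_j a_k (y_j - y_k)^2. *)
Lemma sum_sqr_le_weighted (R : realType) (J : finType) (a y : J -> R) :
  (forall j, 0 <= a j) ->
  (\sum_j a j * y j) ^+ 2 <= (\sum_j a j) * \sum_j a j * y j ^+ 2.
Proof.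
move=> a0.
have : 0 <= \sum_j \sum_k a j * a k * (y j - y k) ^+ 2.
  by apply: sumr_ge0 => j _; apply: sumr_ge0 => k _;
     rewrite mulr_ge0 ?sqr_ge0 ?mulr_ge0.
have -> : \sum_j \sum_k a j * a k * (y j - y k) ^+ 2 =
    2 * ((\sum_j a j) * (\sum_j a j * y j ^+ 2) - (\sum_j a j * y j) ^+ 2).
  pose A := \sum_j a j; pose B := \sum_j a j * y j ^+ 2.
  pose D := \sum_j a j * y j; rewrite -/A -/B -/D.
  transitivity (\sum_j (a j * y j ^+ 2 * A + a j * B - 2 * (a j * y j) * D)).
    apply: eq_bigr => j _; rewrite /A /B /D !mulr_sumr -sumrN -!big_split /=.
    by apply: eq_bigr => k _; ring.
  rewrite !big_split sumrN /= -!mulr_suml -mulr_sumr -/A -/B -/D; ring.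
lra.
Qed.

Section Energy.
Variables (R : realType) (n : nat) (rho : 'I_n -> 'I_n -> R).
Hypothesis rho_ge0 : forall i j, 0 <= rho i j.
Hypothesis rho_sym : forall i j, rho i j = rho j i.

Definition wdeg (i : 'I_n) : R := \sum_j rho i j.

Definition kernel_walk : 'M[R]_n := \matrix_(i, j) (rho i j / wdeg j).

(** The squared norm for which the walk, reversible with respect to [wdeg], is
    self-adjoint; it plays the role of the squared Euclidean norm of u. *)
Definition energy (u : 'cV[R]_n) : R := \sum_j u j 0 ^+ 2 / wdeg j.

Hypothesis wdeg_gt0 : forall i, 0 < wdeg i.

Lemma l1_contraction_kernel_walk : l1_contraction kernel_walk.
Proof.
apply: l1_contraction_col => j.
have -> : \sum_i `|kernel_walk i j| = \sum_i rho j i / wdeg j.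
  apply: eq_bigr => i _.
  by rewrite mxE ger0_norm 1?rho_sym // divr_ge0 // ltW.
by rewrite -mulr_suml -/(wdeg j) divff // gt_eqF.
Qed.

Lemma energy_kernel_walk_le u : energy (kernel_walk *m u) <= energy u.
Proof.
have row_le i : (kernel_walk *m u) i 0 ^+ 2 / wdeg i <=
    \sum_j rho i j * (u j 0 / wdeg j) ^+ 2.
  rewrite ler_pdivrMr // mulrC mxE.
  have -> : \sum_j kernel_walk i j * u j 0 = \sum_j rho i j * (u j 0 / wdeg j).
    by apply: eq_bigr => j _; rewrite mxE mulrAC mulrA.
  exact: sum_sqr_le_weighted.
apply: (@le_trans _ _ (\sum_i \sum_j rho i j * (u j 0 / wdeg j) ^+ 2)).
  by apply: ler_sum => i _; exact: row_le.
rewrite exchange_big /=; apply: ler_sum => j _; rewrite -mulr_suml.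
under eq_bigr => i _ do rewrite rho_sym.
rewrite -/(wdeg j) exprMn mulrCA; apply: ler_wpM2l; first exact: sqr_ge0.
by rewrite expr2 mulrA divff ?mul1r // gt_eqF.
Qed.

(** PageRank is a convex combination of v and of a vector of energy at most its
    own, and energy is convex. *)
Lemma energy_pagerank_le (alpha : R) v : 0 <= alpha < 1 ->
  energy (pagerank alpha kernel_walk v) <= energy v.
Proof.
move=> /[dup] alpha01 /andP[a0 a1].
have := pagerank_fixpoint alpha01 v l1_contraction_kernel_walk.
move: (pagerank _ _ _) => x xE.
have : energy x <= (1 - alpha) * energy v + alpha * energy (kernel_walk *m x).
  rewrite {1}xE /energy !mulr_sumr -big_split; apply: ler_sum => j _ /=.
  rewrite !mulrA -mulrDl ler_wpM2r ?invr_ge0 ?(ltW (wdeg_gt0 j)) //.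
  move: (_ *m x) => y; rewrite !mxE.
  have : 0 <= alpha * (1 - alpha) * (v j 0 - y j 0) ^+ 2.
    by rewrite mulr_ge0 ?sqr_ge0 // mulr_ge0 // subr_ge0 ltW.
  nra.
have := ler_wpM2l a0 (energy_kernel_walk_le x); nra.
Qed.
End Energy.

(** * Random graphs with independent edges *)

Lemma slot_ofC n (i j : 'I_n) : slot_of i j = slot_of j i.
Proof.
apply: val_inj; rewrite /= /sort_pair.
by case: (ltngtP i j) => // /val_inj ->.
Qed.

Lemma slot_of_inj n (i : 'I_n) : injective (slot_of i).
Proof.
move=> j k /(congr1 val); rewrite /= /sort_pair.
by do 2![case: ifP => _] => -[] // -> ->.
Qed.

Lemma card_slot_of_le n (e : slot n) :
  (#|[pred ij : 'I_n * 'I_n | slot_of ij.1 ij.2 == e]| <= 2)%N.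
Proof.
apply: leq_trans (card_size [:: val e; ((val e).2, (val e).1)]).
apply: subset_leq_card; apply/fintype.subsetP => -[i j]; rewrite !inE => /eqP <- /=.
by rewrite /sort_pair; case: ifP => _ /=; rewrite eqxx ?orbT.
Qed.

Lemma adjacency_sym (R : realType) n (g : graph n) i j :
  adjacency R g i j = adjacency R g j i.
Proof. by rewrite !mxE slot_ofC. Qed.

(** The arithmetic-geometric inequality; it bounds a first absolute moment by a
    variance while leaving the scale s to be chosen. *)
Lemma normr_le_sqr (R : realFieldType) (s y : R) :
  0 < s -> `|y| <= 2^-1 * (s + y ^+ 2 / s).
Proof.
move=> s0; suff : `|y| * s <= 2^-1 * (s + y ^+ 2 / s) * s by rewrite ler_pM2r.
have -> : 2^-1 * (s + y ^+ 2 / s) * s = 2^-1 * (s ^+ 2 + y ^+ 2).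
  by field; rewrite gt_eqF.
by have := sqr_ge0 (`|y| - s); rewrite -[in y ^+ 2]real_normK ?num_real //; lra.
Qed.

Lemma ler_sum_trans (R : realFieldType) (I : finType) (F G : I -> R) (b : R) :
  (forall i, F i <= G i) -> \sum_i G i <= b -> \sum_i F i <= b.
Proof. by move=> FG; apply: le_trans; apply: ler_sum. Qed.

Section RandomGraph.
Variables (R : realType) (n : nat) (rho : 'I_n -> 'I_n -> R).
Hypothesis rho01 : forall i j, 0 <= rho i j <= 1.
Hypothesis rho_sym : forall i j, rho i j = rho j i.

Let rho_ge0 i j : 0 <= rho i j. Proof. by case/andP: (rho01 i j). Qed.

Definition slot_rate (e : slot n) : R := rho (val e).1 (val e).2.

Lemma slot_rate_of i j : slot_rate (slot_of i j) = rho i j.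
Proof. by rewrite /slot_rate /= /sort_pair; case: ifP. Qed.

Let slot_rate01 e : 0 <= slot_rate e <= 1. Proof. exact: rho01. Qed.

Definition row_dev (x : 'I_n -> R) (i : 'I_n) (g : graph n) : R :=
  \sum_j (adjacency R g i j - rho i j) * x j.

(** At x = z / w this dominates the l1 norm of (P - Q) z. *)
Definition discrepancy (x : 'I_n -> R) (g : graph n) : R :=
  \sum_i (`|row_dev x i g| + `|degree R g i - wdeg rho i| * `|x i|).

Lemma degree_devE g i : degree R g i - wdeg rho i = row_dev (fun=> 1) i g.
Proof.
rewrite /degree /wdeg -sumrB; apply: eq_bigr => j _; exact/esym/mulr1.
Qed.

Lemma mean_sqr_row_dev_le x i :
  mean slot_rate (fun g => row_dev x i g ^+ 2) <= \sum_j rho i j * x j ^+ 2.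
Proof.
under eq_bigr => j _ do rewrite -slot_rate_of.
apply: le_trans (mean_sqr_centered_le slot_rate01 (@slot_of_inj n i) x).
rewrite le_eqVlt; apply/orP; left; apply/eqP; apply: eq_mean => g.
congr (_ ^+ 2); apply: eq_bigr => j _.
by rewrite slot_rate_of mxE.
Qed.

Lemma mean_norm_row_dev_le x i (s : R) : 0 < s ->
  mean slot_rate (fun g => `|row_dev x i g|) <=
  2^-1 * (s + (\sum_j rho i j * x j ^+ 2) / s).
Proof.
move=> s0.
apply: (le_trans (ler_mean slot_rate01 (fun g => normr_le_sqr _ s0))).
rewrite meanZ meanD mean_cst ler_pM2l ?invr_gt0 // lerD2l.
under eq_mean => g do rewrite mulrC.
by rewrite meanZ mulrC ler_pM2r ?invr_gt0 // mean_sqr_row_dev_le.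
Qed.

(** The entries of the adjacency matrix read at slot e, weighted by x; the factor
    2 accounts for the row part and the degree part of the discrepancy. *)
Definition slot_influence (x : 'I_n -> R) (e : slot n) : R :=
  2 * \sum_(ij : 'I_n * 'I_n) (slot_of ij.1 ij.2 == e)%:R * `|x ij.2|.

Lemma discrepancy_lipschitz x e (g g' : graph n) :
  (forall e', e' != e -> g e' = g' e') ->
  `|discrepancy x g - discrepancy x g'| <= slot_influence x e.
Proof.
move=> gg'.
have dev_le y i : `|row_dev y i g - row_dev y i g'| <=
    \sum_j (slot_of i j == e)%:R * `|y j|.
  rewrite /row_dev -sumrB; apply: le_trans (ler_norm_sum _ _ _) _.
  apply: ler_sum => j _.
  rewrite -mulrBl normrM ler_wpM2r // !mxE opprB addrA subrK.
  case: eqP => [_|/eqP /gg' ->]; last by rewrite subrr normr0.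
  case: (g _); case: (g' _);
    by rewrite /= ?subrr ?subr0 ?sub0r ?normrN ?normr1 ?normr0 ?ler01.
rewrite /discrepancy -sumrB; apply: le_trans (ler_norm_sum _ _ _) _.
have -> : slot_influence x e = \sum_i
    (\sum_j (slot_of i j == e)%:R * `|x j| +
     (\sum_j (slot_of i j == e)%:R * `|1 : R|) * `|x i|).
  rewrite /slot_influence -(pair_bigA _ (fun i j => (slot_of i j == e)%:R * `|x j|)) /=.
  rewrite big_split /= mulr_natl mulr2n; congr (_ + _).
  rewrite exchange_big; apply: eq_bigr => i _; rewrite mulr_suml.
  by apply: eq_bigr => j _; rewrite slot_ofC normr1 mulr1.
apply: ler_sum => i _; rewrite opprD addrACA !degree_devE.
apply: le_trans (ler_normD _ _) _; apply: lerD.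
  exact: le_trans (ler_dist_dist _ _) (dev_le _ _).
rewrite -mulrBl normrM normr_id ler_wpM2r //.
exact: le_trans (ler_dist_dist _ _) (dev_le (fun=> 1) _).
Qed.

(** A slot is read by at most two entries, so the square of a sum over these
    entries costs a factor 2; each entry is then counted once over all slots. *)
Lemma sum_sqr_slot_influence_le x :
  \sum_e slot_influence x e ^+ 2 <= 8 * n%:R * \sum_j x j ^+ 2.
Proof.
have infl_le e : slot_influence x e ^+ 2 <=
    8 * \sum_(ij : 'I_n * 'I_n) (slot_of ij.1 ij.2 == e)%:R * x ij.2 ^+ 2.
  rewrite /slot_influence exprMn.
  have := sum_sqr_le_weighted (fun ij => `|x ij.2|)
    (fun ij : 'I_n * 'I_n => ler0n R (slot_of ij.1 ij.2 == e)).
  under [X in _ <= _ * X]eq_bigr => ij _ do rewrite real_normK ?num_real //.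
  set s := (\sum_ij (slot_of ij.1 ij.2 == e)%:R : R) => cs.
  have s2 : s <= 2.
    rewrite /s -natr_sum ler_nat; apply: leq_trans (card_slot_of_le e).
    rewrite -sum1_card [leqRHS]big_mkcond; apply: leq_sum => ij _.
    by rewrite inE; case: (_ == _).
  have : s * (\sum_(ij : 'I_n * 'I_n) (slot_of ij.1 ij.2 == e)%:R * x ij.2 ^+ 2)
      <= 2 * \sum_(ij : 'I_n * 'I_n) (slot_of ij.1 ij.2 == e)%:R * x ij.2 ^+ 2.
    by rewrite ler_wpM2r // sumr_ge0 // => ij _; rewrite mulr_ge0 ?sqr_ge0.
  lra.
apply: (ler_sum_trans infl_le).
rewrite -mulr_sumr -mulrA ler_pM2l // exchange_big /=.
under eq_bigr => ij _.
  rewrite -mulr_suml (bigD1 (slot_of ij.1 ij.2)) //= eqxx big1 ?addr0 ?mul1r; last first.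
    by move=> e /negPf ne; rewrite eq_sym ne.
  over.
rewrite -(pair_bigA _ (fun i j => x j ^+ 2)) /= sumr_const card_ord.
by rewrite mulr_natl.
Qed.

Lemma isolated_vertex_le i :
  mean slot_rate (fun g => (degree R g i == 0)%:R) <= expR (- wdeg rho i).
Proof.
rewrite /wdeg; under eq_bigr => j _ do rewrite -slot_rate_of.
apply: le_trans (mean_all_absent_le slot_rate01 (@slot_of_inj n i)).
apply: ler_mean => // g; rewrite ler_nat.
case: eqP => // /eqP; rewrite psumr_eq0 => [/allP d0|j _]; last by rewrite mxE.
have /forallP -> // : forall j, ~~ g (slot_of i j) => [j].
have := implyP (d0 j (mem_index_enum j)) isT.
by rewrite mxE pnatr_eq0 eqb0.
Qed.

Section WalkDeviation.
Variables (w B eta : R) (z : 'cV[R]_n).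
Hypotheses (w_gt0 : 0 < w) (eta_gt0 : 0 < eta) (n_gt0 : (0 < n)%N).
Hypothesis w_le : forall i, w <= wdeg rho i.
Hypothesis z_l1 : l1 z <= 1.
Hypothesis z_energy : n%:R * energy rho z * w <= B.

Let wdeg_gt0 i : 0 < wdeg rho i. Proof. exact: lt_le_trans (w_le i). Qed.

Definition scaled (j : 'I_n) : R := z j 0 / wdeg rho j.

(** The two scales are chosen so that both parts have a mean of order eta: each
    row gets eta / n, as there are n of them, and the deviation of the degree i
    gets eta times its mean, since its weight is |z_i| over that mean. *)
Lemma mean_discrepancy_le :
  mean slot_rate (discrepancy scaled) <= eta + (B + 1) / (2 * eta * w).
Proof.
have n0 : 0 < n%:R :> R by rewrite ltr0n.
have rows : \sum_i mean slot_rate (fun g => `|row_dev scaled i g|) <=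
    2^-1 * (eta + n%:R * energy rho z / eta).
  have s0 : 0 < eta / n%:R by rewrite divr_gt0.
  apply: (ler_sum_trans (fun i => mean_norm_row_dev_le scaled i s0)).
  rewrite -mulr_sumr ler_pM2l ?invr_gt0 // big_split /= sumr_const card_ord.
  rewrite -(mulr_natr (eta / _)) divfK ?gt_eqF // lerD2l -mulr_suml exchange_big /=.
  have -> : \sum_j \sum_i rho i j * scaled j ^+ 2 = energy rho z.
    apply: eq_bigr => j _; rewrite -mulr_suml.
    under eq_bigr => i _ do rewrite rho_sym.
    rewrite -/(wdeg rho j) /scaled; field; exact: lt0r_neq0.
  by rewrite invf_div mulrA [energy _ _ * _]mulrC.
have degs : \sum_i mean slot_rate
      (fun g => `|degree R g i - wdeg rho i| * `|scaled i|) <=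
    2^-1 * (eta + 1 / (eta * w)).
  apply: (@le_trans _ _ (\sum_i `|z i 0| * (2^-1 * (eta + 1 / (eta * w))))).
    apply: ler_sum => i _.
    under eq_mean => g do rewrite mulrC degree_devE.
    rewrite meanZ.
    have s0 : 0 < eta * wdeg rho i by rewrite mulr_gt0.
    have := mean_norm_row_dev_le (fun=> 1) i s0.
    have -> : \sum_j rho i j * 1 ^+ 2 = wdeg rho i.
      by apply: eq_bigr => j _; rewrite expr1n mulr1.
    move=> m_le; rewrite /scaled normrM normfV (gtr0_norm (wdeg_gt0 i)) -mulrA.
    apply: ler_wpM2l => //.
    rewrite mulrC ler_pdivrMr //; apply: (le_trans m_le).
    rewrite -mulrA ler_pM2l ?invr_gt0 // mulrDl lerD2l.
    have -> : wdeg rho i / (eta * wdeg rho i) = eta^-1.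
      by field; rewrite !gt_eqF.
    rewrite mul1r invfM -mulrA ler_peMr ?invr_ge0 ?(ltW eta_gt0) //.
    by rewrite mulrC ler_pdivlMr // mul1r.
  rewrite -mulr_suml -/(l1 z) ler_piMl //.
  by rewrite mulr_ge0 ?invr_ge0 // addr_ge0 ?(ltW eta_gt0) // divr_ge0 // mulr_ge0 // ltW.
rewrite /discrepancy mean_sum.
under eq_bigr => i _ do rewrite meanD.
rewrite big_split; apply: le_trans (lerD rows degs) _.
have : n%:R * energy rho z <= B / w by rewrite ler_pdivlMr.
rewrite -(ler_pM2r (_ : 0 < eta^-1)) ?invr_gt0 // => e_le.
have -> : eta + (B + 1) / (2 * eta * w) =
   2^-1 * (eta + B / w / eta) + 2^-1 * (eta + 1 / (eta * w)).
  by field; rewrite !gt_eqF.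
by rewrite lerD2r ler_pM2l ?invr_gt0 // lerD2l.
Qed.

(** Bounded differences for w times the discrepancy, whose squared Lipschitz
    constants sum to at most 8 n w^2 |x|_2^2 <= 8 n w energy <= 8 B. *)
Lemma discrepancy_tail (t : R) :
  mean slot_rate (fun g => (eta + (B + 1) / (2 * eta * w) + t / w <
                            discrepancy scaled g)%R%:R) <=
  expR (16 * B - t).
Proof.
have lip e (g g' : graph n) : (forall e', e' != e -> g e' = g' e') ->
    `|w * discrepancy scaled g - w * discrepancy scaled g'| <=
    w * slot_influence scaled e.
  move=> gg'; rewrite -mulrBr normrM (gtr0_norm w_gt0) ler_pM2l //.
  exact: discrepancy_lipschitz.
have := bounded_differences_tail slot_rate01 t lip.
rewrite meanZ => tail; apply: le_trans (le_trans _ tail) _.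
  apply: ler_mean => // g; rewrite ler_nat.
  case: ltP => // big; rewrite lt0b.
  rewrite -(ltr_pM2l w_gt0) mulrDr [w * (t / w)]mulrC divfK ?gt_eqF // in big.
  by apply: le_lt_trans big; rewrite lerD2r ler_pM2l // mean_discrepancy_le.
rewrite ler_expR lerD2r.
under eq_bigr => e _ do rewrite exprMn.
rewrite -mulr_sumr.
have infl := sum_sqr_slot_influence_le scaled.
have sqr_le : \sum_j scaled j ^+ 2 <= energy rho z / w.
  rewrite /energy mulr_suml; apply: ler_sum => j _; rewrite /scaled.
  rewrite exprMn -mulrA ler_wpM2l ?sqr_ge0 // expr2.
  rewrite ler_wpM2l ?invr_ge0 ?(ltW (wdeg_gt0 j)) //.
  by rewrite lef_pV2 ?posrE.
have n0 : 0 <= 8 * n%:R :> R by [].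
have := le_trans infl (ler_wpM2l n0 sqr_le).
rewrite -(ler_pM2l (exprn_gt0 2 w_gt0)).
have -> : w ^+ 2 * (8 * n%:R * (energy rho z / w)) = 8 * (n%:R * energy rho z * w).
  by field; exact: lt0r_neq0.
have := z_energy; lra.
Qed.

End WalkDeviation.
End RandomGraph.

(** * PageRank on a random graph *)

Lemma mulmx_invmx_diag (F : fieldType) n (A : 'M[F]_n) (d : 'rV[F]_n) :
  (forall j, d 0 j != 0) ->
  A *m invmx (diag_mx d) = \matrix_(i, j) (A i j / d 0 j).
Proof.
move=> d0; have d_unit : diag_mx d \in unitmx.
  by rewrite unitmxE det_diag unitfE prodf_seq_neq0; apply/allP => j _; rewrite d0.
rewrite -[RHS](mulmxK d_unit); congr (_ *m _); apply/matrixP => i j.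
by rewrite mul_mx_diag !mxE divfK.
Qed.

Lemma walk_mxE (R : realType) n (g : graph n) :
  (forall i, 0 < degree R g i) -> walk_mx R g = kernel_walk (adjacency R g).
Proof.
move=> d0; rewrite /walk_mx /degree_mx mulmx_invmx_diag => [|j].
  by apply/matrixP => i j; rewrite !mxE.
by rewrite mxE lt0r_neq0.
Qed.

(** With x = z / w, the entry i of the left-hand vector is
    ((A - A') x)_i + sum_j A_ij (w_j / d_j - 1) x_j; column j of A sums to d_j,
    which turns the second part into |w_j - d_j| |x_j|. *)
Lemma kernel_walk_sub_le (R : realType) n (rho : 'I_n -> 'I_n -> R)
    (g : graph n) (z : 'cV[R]_n) :
  (forall i, 0 < degree R g i) -> (forall i, 0 < wdeg rho i) ->
  l1 ((kernel_walk (adjacency R g) - kernel_walk rho) *m z) <=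
  discrepancy rho (scaled rho z) g.
Proof.
move=> d0 w0; pose x := scaled rho z; pose A := adjacency R g.
pose y j := wdeg rho j / degree R g j - 1.
have entryE i : ((kernel_walk A - kernel_walk rho) *m z) i 0 =
    row_dev rho x i g + \sum_j A i j * (y j * x j).
  rewrite mxE -big_split /=; apply: eq_bigr => j _; rewrite !mxE /y /x /scaled.
  rewrite -[wdeg _ j]/(degree R g j).
  by field; rewrite !lt0r_neq0.
rewrite /l1; apply: (ler_sum_trans (G := fun i =>
  `|row_dev rho x i g| + \sum_j A i j * `|y j * x j|)) => [i|].
  rewrite entryE; apply: (le_trans (ler_normD _ _)); rewrite lerD2l.
  apply: (le_trans (ler_norm_sum _ _ _)); apply: ler_sum => j _.
  by rewrite normrM ger0_norm // mxE.
rewrite big_split /discrepancy big_split lerD2l exchange_big /=.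
apply: ler_sum => j _; rewrite -mulr_suml.
under eq_bigr => i _ do rewrite /A adjacency_sym.
rewrite -/(degree R g j) normrM mulrA ler_wpM2r // distrC.
by rewrite -{1}(gtr0_norm (d0 j)) -normrM /y mulrBr mulr1 mulrC divfK // lt0r_neq0.
Qed.

Section SBM.
Variables (R : realType) (n : nat) (C : {set 'I_n}) (p q : R).

Lemma edge_prob_sym i j : edge_prob C p q i j = edge_prob C p q j i.
Proof. by rewrite /edge_prob eq_sym. Qed.

Lemma mean_degree_mx_wdeg i :
  mean_degree_mx C p q i i = wdeg (edge_prob C p q) i.
Proof.
have meanA j : edge_prob C p q i j =
    \sum_g sbm_weight C p q g * adjacency R g i j.
  have /matrixP/(_ i j) := mean_adjacencyE C p q.
  by rewrite summxE mxE => <-; apply: eq_bigr => g _; rewrite mxE.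
rewrite summxE /wdeg; under [RHS]eq_bigr => j _ do rewrite meanA.
rewrite exchange_big; apply: eq_bigr => g _.
by rewrite !mxE eqxx mulr1n /degree mulr_sumr.
Qed.

Lemma wdeg_edge_prob i :
  wdeg (edge_prob C p q) i = if i \in C then wmax n #|C| p q else wmin n #|C| p q.
Proof.
by rewrite -mean_degree_mx_wdeg mean_degree_mxE !mxE eqxx mulr1n.
Qed.

(** wmax - wmin = (2 |C| - n) (p - q), so the majority community has the larger
    expected degrees. *)
Lemma wmin_le_wdeg i : q <= p -> n%:R / 2 <= #|C|%:R :> R ->
  wmin n #|C| p q <= wdeg (edge_prob C p q) i.
Proof.
move=> qp half; rewrite wdeg_edge_prob; case: ifP => // _; rewrite /wmin /wmax.
rewrite natrB; last by rewrite -[leqRHS]card_ord max_card.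
nra.
Qed.

Lemma mean_walk_mxE : (forall i, 0 < wdeg (edge_prob C p q) i) ->
  mean_walk_mx C p q = kernel_walk (edge_prob C p q).
Proof.
move=> w0; rewrite /mean_walk_mx mean_degree_mxE mulmx_invmx_diag => [|j].
  by apply/matrixP => i j; rewrite mean_adjacencyE !mxE wdeg_edge_prob.
by rewrite mxE -wdeg_edge_prob lt0r_neq0.
Qed.

Lemma sbm_prE (E : pred (graph n)) :
  sbm_pr C p q E = mean (slot_rate (edge_prob C p q)) (fun g => (E g)%:R).
Proof.
rewrite /sbm_pr big_mkcond; apply: eq_bigr => g _.
by case: (E g); rewrite ?mulr1 ?mulr0.
Qed.

(** The non-asymptotic form of the result: outside the event of an isolated
    vertex and that of a large discrepancy, the stability of PageRank applies. *)
Lemma pagerank_close_pr (alpha w B eta t : R) (v : 'cV[R]_n) :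
  0 <= alpha < 1 -> (forall i j, 0 <= edge_prob C p q i j <= 1) ->
  0 < w -> 0 < eta -> (0 < n)%N ->
  (forall i, w <= wdeg (edge_prob C p q) i) ->
  l1 v <= 1 -> n%:R * \sum_i v i 0 ^+ 2 <= B ->
  1 - (n%:R * expR (- w) + expR (16 * B - t)) <=
  sbm_pr C p q (pagerank_close alpha v (pagerank alpha (mean_walk_mx C p q) v)
    (2^-1 * (alpha / (1 - alpha)) *
       (eta + (B + 1) / (2 * eta * w) + t / w))).
Proof.
move=> /[dup] alpha01 /andP[a0 a1] rho01 w0 eta0 n0 w_le v1 vB.
set rho := edge_prob C p q; set bound := eta + _ + _.
have wdeg0 i : 0 < wdeg rho i by apply: lt_le_trans (w_le i).
have rho0 i j : 0 <= rho i j by case/andP: (rho01 i j).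
have rhoC := edge_prob_sym.
rewrite mean_walk_mxE // -/rho.
set z := pagerank alpha (kernel_walk rho) v; set close := pagerank_close _ _ _ _.
have rhoP := l1_contraction_kernel_walk rho0 rhoC wdeg0.
have z1 : l1 z <= 1 by apply: le_trans v1; apply: l1_pagerank_le.
have zB : n%:R * energy rho z * w <= B.
  apply: le_trans vB; rewrite -mulrA ler_wpM2l //.
  apply: (@le_trans _ _ (energy rho v * w)).
    by rewrite ler_wpM2r ?(ltW w0) // energy_pagerank_le.
  rewrite /energy mulr_suml; apply: ler_sum => i _.
  by rewrite mulrAC ler_pdivrMr // ler_wpM2l ?sqr_ge0.
have tail := discrepancy_tail rho01 rhoC w0 eta0 n0 w_le z1 zB t.
have isolated : \sum_i mean (slot_rate rho) (fun g => (degree R g i == 0)%:R) <=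
    n%:R * expR (- w).
  have -> : n%:R * expR (- w) = \sum_(i < n) expR (- w).
    by rewrite sumr_const card_ord mulr_natl.
  apply: ler_sum => i _.
  apply: (le_trans (isolated_vertex_le rho01 rhoC i)).
  by rewrite ler_expR lerN2.
rewrite sbm_prE lerBlDr.
apply: le_trans (lerD (lexx _) (lerD isolated tail)).
rewrite -mean_sum -!meanD -[leLHS](mean_cst (slot_rate rho)).
apply: ler_mean => [e|g]; first exact: rho01.
have [/forallP d0|/forallPn[i]] := boolP [forall i, 0 < degree R g i]; last first.
  rewrite -leNgt => di; rewrite (bigD1 i) //=.
  have -> : degree R g i == 0.
    by rewrite eq_le di; apply: sumr_ge0 => j _; rewrite mxE.
  by rewrite addrCA -addrA lerDl !addr_ge0 // sumr_ge0.
case: ltP => [_|f_le]; first by rewrite addrA lerDr addr_ge0 // sumr_ge0.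
suff -> : close g by rewrite lerDl addr_ge0 // sumr_ge0.
rewrite /close /pagerank_close; apply/andP; split; first exact/forallP.
have A0 i j : 0 <= adjacency R g i j by rewrite mxE.
have gP := l1_contraction_kernel_walk A0 (adjacency_sym R g) d0.
rewrite walk_mxE // /tv_dist -mulrA ler_pM2l ?invr_gt0 //.
have -> : \sum_i `|pagerank alpha (kernel_walk (adjacency R g)) v i 0 - z i 0| =
    l1 (pagerank alpha (kernel_walk (adjacency R g)) v - z).
  by apply: eq_bigr => i _; rewrite !mxE.
apply: (le_trans (l1_pagerank_sub_le alpha01 v gP rhoP)).
rewrite ler_wpM2l ?divr_ge0 ?subr_ge0 ?(ltW a1) //.
exact: le_trans (kernel_walk_sub_le _ d0 wdeg0) f_le.
Qed.
End SBM.

(** * Asymptotics *)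

Lemma near_le_ln_nat (R : realType) (M : R) :
  \forall n \near \oo, M <= ln (n%:R : R).
Proof.
apply: filterS (nbhs_infty_ger (expR M)) => n Mn.
have n0 : 0 < n%:R :> R by apply: lt_le_trans Mn; exact: expR_gt0.
by rewrite -[M]expRK ler_ln ?posrE ?expR_gt0.
Qed.

Lemma cvg_inv_ln_nat (R : realType) : (ln (n%:R : R))^-1 @[n --> \oo] --> (0 : R).
Proof.
apply/cvgr0Pnorm_le => eps eps0.
apply: filterS (near_le_ln_nat eps^-1) => n le_ln.
have ln0 : 0 < ln (n%:R : R) by apply: lt_le_trans le_ln; rewrite invr_gt0.
by rewrite ger0_norm ?invr_ge0 ?(ltW ln0) // -[eps]invrK lef_pV2 ?posrE ?invr_gt0.
Qed.

Lemma le_of_littleo_ln3 (R : realType) (w : nat -> R) :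
  (forall n, (0 < n)%N -> 0 <= w n) ->
  (fun n : nat => ln (n%:R : R) ^+ 3) =o_\oo w ->
  forall eps : R, 0 < eps -> \forall n \near \oo, ln (n%:R : R) <= eps * w n.
Proof.
move=> w0 /eqoP o_ln eps eps0.
near=> n.
have ln1 : 1 <= ln (n%:R : R) by near: n; exact: near_le_ln_nat.
have n0 : (0 < n)%N by near: n; exact: nbhs_infty_gt.
have : `|ln (n%:R : R) ^+ 3| <= eps * `|w n| by near: n; exact: o_ln.
rewrite (ger0_norm (w0 _ n0)) => /(le_trans (ler_norm _)); apply: le_trans.
nra.
Unshelve. all: by end_near. Qed.

Theorem theorem3 (R : realType) (alpha : R)
  (m : nat -> nat) (C1 : forall n : nat, {set 'I_n})
  (p q : nat -> R) (v : forall n : nat, 'cV[R]_n) (C : R)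
  (halpha : 0 <= alpha < 1)
  (hC1 : forall n : nat, (0 < n)%N -> #|C1 n| = m n)
  (hm : forall n : nat, (0 < n)%N -> n%:R / 2 < (m n)%:R :> R)
  (hpq : forall n : nat, (0 < n)%N -> [/\ 0 <= q n, q n < p n & p n <= 1])
  (hv : forall n : nat, (0 < n)%N -> prob_vector (v n))
  (hwmin : (fun n : nat => (ln (n%:R : R)) ^+ 3)
             =o_\oo (fun n : nat => wmin n (m n) (p n) (q n)))
  (hw : forall n : nat, (0 < n)%N ->
          wmax n (m n) (p n) (q n) / wmin n (m n) (p n) (q n) <= C)
  (hv2 : (fun n : nat => norm2 (v n))
           =O_\oo (fun n : nat => (Num.sqrt (n%:R : R))^-1)) :
  exists psi : nat -> R,
    psi @ \oo --> (0 : R) /\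
    whp (fun n : nat =>
      sbm_pr (C1 n) (p n) (q n)
        (pagerank_close alpha (v n)
           (pagerank alpha (mean_walk_mx (C1 n) (p n) (q n)) (v n))
           (psi n))).
Proof.
pose w n := wmin n (m n) (p n) (q n).
have w_ge0 n : (0 < n)%N -> 0 <= w n.
  move=> /hpq[q0 qp _]; rewrite /w /wmin.
  by rewrite addr_ge0 // mulr_ge0 // ltW // (le_lt_trans q0).
have ln_le := le_of_littleo_ln3 w_ge0 hwmin.
have [K K0 v_le] := (eqO_exP _ _ _).1 hv2.
pose B := K ^+ 2.
(* The non-asymptotic bound for eta = 1 / ln n and t = ln n, using that
   1 / (eta w) = ln n / w. *)
exists (fun n => 2^-1 * (alpha / (1 - alpha)) *
  ((ln n%:R)^-1 + ((B + 1) / 2 + 1) * (ln n%:R / w n))); split.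
  have ratio0 : (ln n%:R / w n) @[n --> \oo] --> (0 : R).
    apply/cvgr0Pnorm_le => eps eps0; near=> n.
    have ln1 : 1 <= ln (n%:R : R) by near: n; exact: near_le_ln_nat.
    have le_eps : ln (n%:R : R) <= eps * w n by near: n; exact: ln_le.
    have w0 : 0 < w n by rewrite -(pmulr_rgt0 _ eps0); lra.
    rewrite ger0_norm ?ler_pdivrMr // divr_ge0 ?ltW //; lra.
  rewrite -[X in _ --> X](mulr0 (2^-1 * (alpha / (1 - alpha)))).
  apply: cvgM; first exact: cvg_cst.
  rewrite -[X in _ --> X](addr0 0); apply: cvgD; first exact: cvg_inv_ln_nat.
  rewrite -[X in _ --> X](mulr0 ((B + 1) / 2 + 1)).
  by apply: cvgM ratio0; exact: cvg_cst.
have : \forall n \near \oo, [/\ (0 < n)%N, 1 <= ln (n%:R : R),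
    ln (n%:R : R) <= 2^-1 * w n &
    `|norm2 (v n)| <= K * `|(Num.sqrt (n%:R : R))^-1| ].
  near=> n; split; near: n.
  - exact: nbhs_infty_gt.
  - exact: near_le_ln_nat.
  - by apply: ln_le; rewrite invr_gt0.
  - exact: v_le.
case=> N _ large; exists N, 1, (1 + expR (16 * B)); split => // n Nn.
have [n0 ln1 ln_w vK] := large n (ltnW Nn).
have nR0 : 0 < n%:R :> R by rewrite ltr0n.
have w0 : 0 < w n by lra.
have [q0 qp p1] := hpq n n0.
have rho01 i j : 0 <= edge_prob (C1 n) (p n) (q n) i j <= 1.
  by rewrite /edge_prob; case: ifP => _; apply/andP; split; lra.
have w_le i : w n <= wdeg (edge_prob (C1 n) (p n) (q n)) i.
  rewrite /w -(hC1 n n0); apply: wmin_le_wdeg; first exact: ltW.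
  by rewrite (hC1 n n0) ltW ?hm.
have [v_ge0 v_sum] := hv n n0.
have v1 : l1 (v n) <= 1.
  by rewrite -v_sum; apply: ler_sum => i _; rewrite ger0_norm.
have vB : n%:R * \sum_i v n i 0 ^+ 2 <= B.
  move: vK; rewrite !ger0_norm ?invr_ge0 ?sqrtr_ge0 // ler_pdivlMr ?sqrtr_gt0 //.
  rewrite /norm2 -sqrtrM ?sumr_ge0 // => {}vK.
  have -> : n%:R * \sum_i v n i 0 ^+ 2 = (\sum_i `|v n i 0| ^+ 2) * n%:R.
    by rewrite mulrC; under [in RHS]eq_bigr do rewrite real_normK ?num_real //.
  rewrite -[leLHS]sqr_sqrtr; last by rewrite mulr_ge0 // sumr_ge0.
  by rewrite /B lerXn2r ?nnegrE ?sqrtr_ge0 // ltW.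
have ln0 : 0 < (ln (n%:R : R))^-1 by rewrite invr_gt0; lra.
have := pagerank_close_pr (ln n%:R) halpha rho01 w0 ln0 n0 w_le v1 vB.
have -> : (ln n%:R)^-1 + (B + 1) / (2 * (ln n%:R)^-1 * w n) + ln n%:R / w n =
    (ln n%:R)^-1 + ((B + 1) / 2 + 1) * (ln n%:R / w n).
  by field; rewrite !lt0r_neq0 //; lra.
apply: le_trans; rewrite lerD2l lerN2 powR_inv1 // (mulrDl 1 (expR _)) mul1r.
rewrite expRD (expRN (ln _)) lnK ?posrE // lerD2r.
have -> : n%:R^-1 = n%:R * expR (- (2 * ln n%:R)) :> R.
  rewrite (mulr_natl (ln _) 2) mulr2n expRN expRD lnK ?posrE //.
  by field; exact: lt0r_neq0.
by rewrite ler_wpM2l ?ler_expR //; lra.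
Unshelve. all: by end_near. Qed.
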